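(* For every $d\ge 2$, the graph $\mathcal{D}_{2d-2}(\mathbb{Q}^d)$ is connected and has diameter at most $(d-1)2^{d-1}$.
   Context: $\mathbb{Q}^d$ is the unit hypercube graph with vertex set $\{1,2\}^d$, two vertices adjacent iff they differ in exactly one coordinate. A dimer configuration on a graph $G$ is a perfect matching; its edges are dimers. An alternating cycle is a cycle of even length in which every second edge is a dimer; switching it exchanges dimer and non-dimer edges along the cycle. For $\ell\ge 2$, $\mathcal{D}_\ell(G)$ is the graph on dimer configurations of $G$ in which two configurations are adjacent if one is obtained from the other by switching an alternating cycle of length at most $2\ell$. *)

(* Defs.v *)
(* A graph is given by its adjacency relation on a finType of vertices. *)
From mathcomp Require Import all_boot.

Set Implicit Arguments.
Unset Strict Implicit.
Unset Printing Implicit Defensive.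

Section Metric.
Variables (T : finType) (e : rel T).

Definition connected_graph : bool :=
  (0 < #|T|) && [forall x, forall y, connect e x y].

Definition walk_of_length (x y : T) (k : nat) : bool :=
  [exists p : k.-tuple T, path e x p && (last x p == y)].

(* A shortest path has fewer than #|T| edges; [find] returns #|T| when y is
   not reachable from x. *)
Definition gdist (x y : T) : nat :=
  find (walk_of_length x y) (iota 0 #|T|).

Definition diameter : nat := \max_(x : T) \max_(y : T) gdist x y.

End Metric.

Section Dimers.
Variables (T : finType) (e : rel T).

Definition edges : {set {set T}} :=
  [set E | [exists x, exists y, e x y && (E == [set x; y])]].

Definition perfect_matching (M : {set {set T}}) : bool :=
  (M \subset edges) && [forall x, #|[set E in M | x \in E]| == 1].

Definition dimer_config : Type := {M : {set {set T}} | perfect_matching M}.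

Definition cycle_edges (c : seq T) : seq {set T} :=
  [seq [set x; next c x] | x <- c].

(* A cycle is listed by its vertices; [2 < size c] excludes a single edge
   traversed back and forth, which [ucycle] accepts. The boolean b says whether
   the dimers sit at odd or at even positions. *)
Definition alternating_cycle (M : {set {set T}}) (c : seq T) : bool :=
  [&& ucycleb e c, 2 < size c, ~~ odd (size c) &
      [exists b : bool, [forall i : 'I_(size c),
         (odd i == b) ==> (nth set0 (cycle_edges c) i \in M)]]].

Definition switch (M : {set {set T}}) (c : seq T) : {set {set T}} :=
  let C := [set:: cycle_edges c] in (M :\: C) :|: (C :\: M).

Definition switchable (l : nat) (M N : dimer_config) : bool :=
  [exists k : 'I_(2 * l).+1, exists c : k.-tuple T,
     alternating_cycle (val M) c && (val N == switch (val M) c)].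

Lemma switchableP (l : nat) (M N : dimer_config) :
  reflect (exists c : seq T, [/\ alternating_cycle (val M) c,
             size c <= 2 * l & val N = switch (val M) c])
          (switchable l M N).
Proof.
apply: (iffP existsP) => [[k /existsP[c /andP[altc /eqP eN]]]|[c [altc lec eN]]].
  by exists c; split=> //; rewrite size_tuple -ltnS.
rewrite -ltnS in lec; exists (Ordinal lec).
by apply/existsP; exists (in_tuple c); rewrite altc eN eqxx.
Qed.

Definition dimer_graph (l : nat) : rel dimer_config :=
  [rel M N | switchable l M N || switchable l N M].

End Dimers.

Arguments switchable {T} e l M N.
Arguments switchableP {T} e l M N.
Arguments dimer_graph {T} e l.

(* The two coordinate values 1 and 2 are represented by the booleans. *)
Definition hypercube (d : nat) : rel {ffun 'I_d -> bool} :=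
  [rel x y : {ffun _ -> bool} | #|[set i | x i != y i]| == 1].
Arguments hypercube d : clear implicits.

(* Main.v *)
Require Import Defs.
From mathcomp Require Import all_boot all_order all_algebra.
From mathcomp Require Import ring lra zify.

(* Induct on the set D of directions used by the dimers, keeping the vertex set
   of the whole cube, so that the cube splits into disjoint subcubes spanned by
   D. It suffices to remove all dimers of one direction v in D ("vertical") from
   each of the two configurations by at most 2^(d-2) switches. A vertical dimer
   lies on an alternating cycle of length at most 4(|D| - 1) whose non-dimer
   edges are not vertical: by Harper's vertex-isoperimetric inequality, in a form
   valid for several disjoint cubes, the number of dimers reached by alternating
   paths of k non-vertical non-dimer edges is at least the size of a ball of
   radius k in the (|D| - 2)-cube, so a forward and a backward search of
   |D| - 1 steps each cover half of the dimers of the subcube, one of them more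
   than half, and meet. Switching such a cycle creates no vertical dimer and removes at least
   two. *)

Set Implicit Arguments.
Unset Strict Implicit.
Unset Printing Implicit Defensive.

Import Order.TTheory GRing.Theory Num.Theory.

(** * Partial binomial sums, the sizes of Hamming balls *)

Definition binsum m r := \sum_(i < r) 'C(m, i).

Lemma binsumSr m r : binsum m r.+1 = binsum m r + 'C(m, r).
Proof. by rewrite /binsum big_ord_recr. Qed.

Lemma binsumS m r : binsum m.+1 r.+1 = binsum m r.+1 + binsum m r.
Proof.
elim: r => [|r IHr]; first by rewrite /binsum !big_ord1 big_ord0 !bin0.
by rewrite binsumSr IHr binS addnACA -!binsumSr.
Qed.

Lemma binsum_pow m : binsum m m.+1 = 2 ^ m.
Proof.
elim: m => [|m IHm]; first by rewrite /binsum big_ord1 bin0.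
by rewrite binsumS IHm binsumSr IHm bin_small // addn0 expnS mul2n addnn.
Qed.

(** For [r.+2 <= m], absorption turns the left side times [r.+2 * (m - r)] into the right side times
    [r.+1 * (m - r.+1)], a smaller factor. *)
Lemma bin_log_concave m r : 'C(m, r) * 'C(m, r.+2) <= 'C(m, r.+1) ^ 2.
Proof.
have H1 := mul_bin_left m r; have H2 := mul_bin_left m r.+1.
have [lt_mr|le_rm] := ltnP m r.+2; first by rewrite (bin_small lt_mr) muln0.
rewrite -(@leq_pmul2l (r.+2 * (m - r))); last by rewrite muln_gt0 subn_gt0; lia.
suff -> : r.+2 * (m - r) * ('C(m, r) * 'C(m, r.+2)) = (r.+1 * (m - r.+1)) * 'C(m, r.+1) ^ 2.
  by rewrite leq_mul2r leq_mul ?orbT //; lia.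
transitivity (((m - r) * 'C(m, r)) * (r.+2 * 'C(m, r.+2))); first by ring.
by rewrite -H1 H2; ring.
Qed.

(** * Growth of interpolated balls under Pascal's rule *)

Section Grows.
Local Open Scope ring_scope.

(* With b = binsum m extended linearly between integers, [grows m a y] says
   b(s) <= a -> b(s + 1) <= y for all rational s >= 1. Both the hypothesis and the
   conclusion are compatible with Pascal's rule b_{m+1}(s) = b_m(s) + b_m(s-1),
   which is why non-integral s are needed although only integral s are used
   in the end. *)
Definition grows m a y := forall r (t : rat), 0 <= t <= 1 ->
  (binsum m r.+1)%:R + t * 'C(m, r.+1)%:R <= a%:R :> rat ->
  (binsum m r.+2)%:R + t * 'C(m, r.+2)%:R <= y%:R :> rat.

(* Compare (a0, a1) with the extremal splitting (b_m(s), b_m(s - 1)). If a0 is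
   at least b_m(s), then y1 >= a0 suffices; otherwise (a0, a1) is more balanced
   and the map b_m(s) |-> b_m(s + 1) is concave by log-concavity of binomials. *)
Lemma grows_add m a0 a1 y0 y1 : grows m a0 y0 -> grows m a1 y1 ->
  (a1 <= y0)%N -> (a0 <= y1)%N -> grows m.+1 (a0 + a1) (y0 + y1).
Proof.
wlog le_a : a0 a1 y0 y1 / (a1 <= a0)%N.
  move=> W g0 g1 le1 le0; case/orP: (leq_total a1 a0) => le_a.
    exact: (W a0 a1).
  by rewrite addnC (addnC y0); apply: (W a1 a0).
move=> g0 g1 _ le0 r t /andP[t_ge0 t_le1].
have lc : 'C(m, r)%:R * 'C(m, r.+2)%:R <= 'C(m, r.+1)%:R ^+ 2 :> rat.
  by rewrite -natrX -natrM ler_nat bin_log_concave.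
(* Growth one index lower. At [r = 0] the two bounds on [a] contradict each other, since
   [binsum m 1] is 1. *)
have pred_r a y : (0 < a)%N -> (a < binsum m r.+1)%N -> grows m a y ->
    forall u : rat, 0 <= u <= 1 ->
    (binsum m r)%:R + u * 'C(m, r)%:R <= a%:R :> rat ->
    (binsum m r.+1)%:R + u * 'C(m, r.+1)%:R <= y%:R :> rat.
  case: r {lc} => [|r] a_gt0 lt_a g; last exact: g.
  by move: lt_a; rewrite binsumSr bin0 /binsum big_ord0 ltnNge a_gt0.
rewrite !binsumS !binS !(binsumSr m r.+1) (binsumSr m r) !natrD.
move: (g0 r) (g1 r) (pred_r a0 y0) (pred_r a1 y1).
rewrite !(binsumSr m r.+1) (binsumSr m r) !natrD.
move: le_a le0 lc.
rewrite -!(ltr_nat rat) -!(ler_nat rat) !natrD.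
have : 0 <= (binsum m r)%:R :> rat by [].
have : 0 <= 'C(m, r)%:R :> rat by [].
have : 0 <= 'C(m, r.+1)%:R :> rat by [].
have : 0 <= 'C(m, r.+2)%:R :> rat by [].
move: (binsum m r)%:R 'C(m, r)%:R 'C(m, r.+1)%:R 'C(m, r.+2)%:R.
move: (a0%:R) (a1%:R) (y0%:R) (y1%:R) => a b y z B c0 c1 c2.
move=> c2_ge0 c1_ge0 c0_ge0 B_ge0 le_ba le_az lc gy gz py pz hab.
have {}py := fun h1 h2 => py h1 h2 g0.
have {}pz := fun h1 h2 => pz h1 h2 g1.
have unit01 (x w : rat) : 0 <= x -> x <= w -> 0 < w -> 0 <= x / w <= 1.
  by move=> *; rewrite divr_ge0 ?ler_pdivrMr ?mul1r //; apply: ltW; rewrite ?(le_lt_trans _ _).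
have [le_a|lt_a] := leP (B + c0 + t * c1) a.
  have := gy t; rewrite t_ge0 t_le1 => /(_ isT le_a); lra.
have lt_b : B + t * c0 < b by lra.
have tc0 : 0 <= t * c0 by rewrite mulr_ge0.
have tc1 : t * c1 <= c1 by rewrite ler_piMl.
have tc0' : t * c0 <= c0 by rewrite ler_piMl.
(* The breakpoint [B + c0] of the interpolation gives three cases: [a] and [b] both above it, on
   either side, or both below. In each, [u] and [v] are the positions of [a] and [b] within their
   segments. *)
have [le_b|lt_b'] := leP (B + c0) b.
  have c1_gt0 : 0 < c1 by rewrite lt0r c1_ge0 andbT; apply/eqP => c10; rewrite c10 in lt_a; lra.
  have Ea : (a - (B + c0)) / c1 * c1 = a - (B + c0) by rewrite divfK ?gt_eqF.
  have Eb : (b - (B + c0)) / c1 * c1 = b - (B + c0) by rewrite divfK ?gt_eqF.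
  have /gy : 0 <= (a - (B + c0)) / c1 <= 1 by apply: unit01; lra.
  have /gz : 0 <= (b - (B + c0)) / c1 <= 1 by apply: unit01; lra.
  move: Ea Eb; set u := (a - _) / _; set v := (b - _) / _ => Ea Eb.
  rewrite Ea Eb => /(_ ltac:(lra)) hz /(_ ltac:(lra)) hy.
  (* Multiplied by [c1], the slack is a nonnegative combination of the log-concavity gap and the
     surplus of [a + b] in [hab]. *)
  suff : 0 <= c1 * (c1 + (u + v) * c2 - t * c2 - t * c1).
    by rewrite pmulr_rge0 //; lra.
  have -> : c1 * (c1 + (u + v) * c2 - t * c2 - t * c1) =
    (1 - t) * (c1 ^+ 2 - c0 * c2) + c2 * (u * c1 + v * c1 - (t * c0 + t * c1 - c0)) by ring.
  by rewrite addr_ge0 ?mulr_ge0 ?subr_ge0 // Ea Eb; lra.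
have c0_gt0 : 0 < c0 by lra.
have b_gt0 : 0 < b by lra.
have Eb : (b - B) / c0 * c0 = b - B by rewrite divfK ?gt_eqF.
have /(pz b_gt0 lt_b') : 0 <= (b - B) / c0 <= 1 by apply: unit01; lra.
move: Eb; set v := (b - _) / _ => Eb; rewrite Eb => /(_ ltac:(lra)) hz.
have [le_a'|lt_a'] := leP (B + c0) a.
  have c1_gt0 : 0 < c1 by rewrite lt0r c1_ge0 andbT; apply/eqP => c10; rewrite c10 in lt_a; lra.
  have Ea : (a - (B + c0)) / c1 * c1 = a - (B + c0) by rewrite divfK ?gt_eqF.
  have /gy : 0 <= (a - (B + c0)) / c1 <= 1 by apply: unit01; lra.
  move: Ea; set u := (a - _) / _ => Ea; rewrite Ea => /(_ ltac:(lra)) hy.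
  suff : 0 <= c0 * ((v - t) * c1 - (t - u) * c2) by rewrite pmulr_rge0 //; lra.
  have u_le : u <= t by rewrite -(ler_pM2r c1_gt0) Ea; lra.
  have -> : c0 * ((v - t) * c1 - (t - u) * c2) =
    (t - u) * (c1 ^+ 2 - c0 * c2) + c1 * (v * c0 - t * c0 - (t * c1 - u * c1)) by ring.
  by rewrite addr_ge0 ?mulr_ge0 ?subr_ge0 // Ea Eb; lra.
have a_gt0 : 0 < a by lra.
have Ea : (a - B) / c0 * c0 = a - B by rewrite divfK ?gt_eqF.
have /(py a_gt0 lt_a') : 0 <= (a - B) / c0 <= 1 by apply: unit01; lra.
move: Ea; set u := (a - _) / _ => Ea; rewrite Ea => /(_ ltac:(lra)) hy.
suff : 0 <= c0 * ((u + v) * c1 - c1 - t * c2 - t * c1).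
  by rewrite pmulr_rge0 //; lra.
have -> : c0 * ((u + v) * c1 - c1 - t * c2 - t * c1) =
  t * (c1 ^+ 2 - c0 * c2) + c1 * (u * c0 + v * c0 - (c0 + t * c0 + t * c1)) by ring.
by rewrite addr_ge0 ?mulr_ge0 ?subr_ge0 // Ea Eb; lra.
Qed.

End Grows.

(** * Vertex isoperimetry in disjoint subcubes *)

Section Flip.
Variable d : nat.
Local Notation V := {ffun 'I_d -> bool}.
Implicit Types (x y z : V) (i j : 'I_d) (D : {set 'I_d}) (A : {set V}).

Definition flip i x : V := [ffun j => (j == i) (+) x j].

Lemma flipE i x : flip i x i = ~~ x i. Proof. by rewrite ffunE eqxx. Qed.

Lemma flip_neq i j x : j != i -> flip i x j = x j.
Proof. by rewrite ffunE => /negPf->. Qed.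

Lemma flipK i : involutive (flip i).
Proof. by move=> x; apply/ffunP => j; rewrite !ffunE addKb. Qed.

Lemma flip_dir i j x : flip i x = flip j x -> i = j.
Proof.
move/ffunP/(_ i); rewrite flipE; case: (eqVneq i j) => // /flip_neq->.
by case: (x i).
Qed.

(** The proper 2-colouring of the cube: every edge has exactly one even end. *)
Definition par x := \big[addb/false]_j x j.

Lemma par_flip i x : par (flip i x) = ~~ par x.
Proof.
rewrite /par (eq_bigr (fun j => (j == i) (+) x j)) => [|j _]; last by rewrite ffunE.
rewrite big_split /= (bigD1 i) //= eqxx big1 ?addTb // => j /negPf->.
by [].
Qed.

Lemma hypercubeP x y : reflect (exists i, y = flip i x) (hypercube d x y).
Proof.
apply: (iffP cards1P) => [[i /setP E]|[i ->]]; exists i.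
  apply/ffunP => j; move: (E j); rewrite !inE ffunE => <-.
  by case: (x j) (y j) => [] [].
by apply/setP => j; rewrite !inE ffunE; case: (j == i) (x j) => [] [].
Qed.

Lemma hypercube_flip i x : hypercube d x (flip i x).
Proof. by apply/hypercubeP; exists i. Qed.

Lemma hypercube_sym x y : hypercube d x y = hypercube d y x.
Proof. by apply/hypercubeP/hypercubeP => -[i ->]; exists i; rewrite flipK. Qed.

(* Open neighbourhood: A itself is not included. *)
Definition nbh D A := [set y | [exists i in D, flip i y \in A]].

Lemma nbhP D A y : reflect (exists2 i, i \in D & flip i y \in A) (y \in nbh D A).
Proof. by rewrite inE; apply: (iffP exists_inP). Qed.

(* Cutting along a direction j of D, each half of the neighbourhood contains
   the neighbourhood of the same half of A and the flip of the other half. *)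
Lemma nbh_grows D m A : #|D| = m.+1 -> grows m #|A| #|nbh D A|.
Proof.
elim: m D A => [|m IHm] D A cD.
  (* With one direction the neighbourhood is a flip of [A], of equal size; this suffices because
     ['C(0, r.+1)] vanishes. *)
  have /eqP/cards1P[i ->] := cD.
  have -> : nbh [set i] A = flip i @: A.
    apply/setP => y; apply/nbhP/imsetP => [[j /set1P-> Aj]|[z Az ->]].
      by exists (flip i y); rewrite ?flipK.
    by exists i; rewrite ?set11 ?flipK.
  rewrite card_imset; last exact: (can_inj (flipK i)).
  move=> r t t01; rewrite !bin_small // !mulr0 !addr0 => leA.
  apply: le_trans leA; by rewrite ler_nat (binsumSr 0 r.+1) bin_small // addn0.
have [j Dj] : exists j, j \in D by apply/card_gt0P; rewrite cD.
have cD' : #|D :\ j| = m.+1 by move: cD; rewrite (cardsD1 j D) Dj => -[].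
pose half (b : bool) (B : {set V}) := [set x in B | x j == b].
have card_half (B : {set V}) : #|B| = #|half false B| + #|half true B|.
  rewrite -(cardsID [set x : V | x j == false] B); congr (_ + _); apply: eq_card => x.
    by rewrite !inE.
  by rewrite !inE; case: (x j) => //=; rewrite andbC.
have sub_half b : nbh (D :\ j) (half b A) \subset half b (nbh D A).
  apply/subsetP => y /nbhP[i /setD1P[ij Di]]; rewrite inE => /andP[Ai Aij].
  rewrite inE; apply/andP; split; first by apply/nbhP; exists i.
  by rewrite flip_neq // eq_sym in Aij.
have flip_half b : #|half (~~ b) A| <= #|half b (nbh D A)|.
  rewrite -(card_imset _ (can_inj (flipK j))); apply/subset_leq_card/subsetP.
  move=> _ /imsetP[x /[!inE] /andP[Ax /eqP xj] ->]; rewrite flipE xj negbK eqxx andbT.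
  by apply/exists_inP; exists j; rewrite ?flipK.
rewrite (card_half A) (card_half (nbh D A)).
apply: grows_add (flip_half false) (flip_half true).
  move=> r t t01 /(IHm _ _ cD' _ _ t01)/le_trans; apply.
  by rewrite ler_nat subset_leq_card.
move=> r t t01 /(IHm _ _ cD' _ _ t01)/le_trans; apply.
by rewrite ler_nat subset_leq_card.
Qed.

(** The integral case [t = 0] of growth: passing to the neighbourhood raises the radius of the
    comparison ball by one. *)
Lemma nbh_ball D m A r : #|D| = m.+1 ->
  binsum m r.+1 <= #|A| -> binsum m r.+2 <= #|nbh D A|.
Proof.
move=> cD; have := @nbh_grows D m A cD r 0%R.
by rewrite !mul0r !addr0 lexx ler01 !ler_nat; apply.
Qed.

End Flip.

(** * Short alternating cycles through a vertical dimer *)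

Section Cycle.
Variable d : nat.
Local Notation V := {ffun 'I_d -> bool}.
Implicit Types (x y z : V) (i j v : 'I_d) (D H : {set 'I_d}) (A : {set V}) (mu : V -> V).

(** A matching is encoded by its partner map; being an involution, this map preserves the sizes of
    sets. *)
Definition dimer_fun D mu :=
  involutive mu /\ forall x, exists2 i, i \in D & mu x = flip i x.

Definition same_class D : rel V :=
  [rel x y | (par x == par y) && [forall i, (i \notin D) ==> (x i == y i)]].

Lemma same_classP D x y :
  reflect (par x = par y /\ forall i, i \notin D -> x i = y i) (same_class D x y).
Proof.
apply: (iffP andP) => -[/eqP pxy xy]; split => //.
  by move=> i Di; apply/eqP/(implyP (forallP xy i)).
by apply/forallP => i; apply/implyP => /xy->.
Qed.

(** The class and its flip along a direction of [D] are disjoint, of equal size, and lie in one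
    subcube with [2 ^ m.+1] vertices. *)
Lemma card_same_class D m x : #|D| = m.+1 -> #|same_class D x| <= 2 ^ m.
Proof.
move=> cD; have [j Dj] : exists j, j \in D by apply/card_gt0P; rewrite cD.
pose S := [set y | same_class D x y].
have cS : #|same_class D x| = #|S| by apply: eq_card => y; rewrite !inE.
have cSf : #|flip j @: S| = #|S| by rewrite card_imset //; apply: can_inj (flipK j).
have disj : S :&: flip j @: S = set0.
  apply/setP => y; rewrite !inE; apply/negP => /andP[/same_classP[pxy _]].
  move=> /imsetP[z /[!inE] /same_classP[pxz _] Ey].
  by move: pxy; rewrite pxz Ey par_flip; case: (par z).
rewrite cS -(@leq_pmul2l 2) // -expnS -cD -[2 in X in _ <= X]card_bool.
rewrite -(@card_pffun_on _ _ false) mul2n -addnn -{2}cSf -cardsUI disj cards0 addn0.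
pose g y : V := [ffun i => x i (+) y i].
have gK : involutive g by move=> y; apply/ffunP => i; rewrite !ffunE addKb.
rewrite -(card_imset _ (can_inj gK)); apply/subset_leq_card/subsetP => _ /imsetP[y Sy ->].
apply/pffun_onP; split=> //; apply/supportP => i Di; rewrite ffunE.
suff -> : y i = x i by rewrite addbb.
case/setUP: Sy => [|/imsetP[z + ->]]; rewrite inE => /same_classP[_ /(_ _ Di)->] //.
by rewrite flip_neq //; apply: contraNneq Di => ->.
Qed.

(* A step is a non-dimer edge followed by a dimer, so that closed walks for
   [step] are alternating. *)
Definition step H mu : rel V := [rel x y | [exists i in H, flip i x == mu y]].

Lemma stepP H mu x y : reflect (exists2 i, i \in H & flip i x = mu y) (step H mu x y).
Proof. by apply: (iffP exists_inP) => -[i Hi /eqP]; exists i => //; apply/eqP. Qed.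

Lemma step_class D H mu x y : H \subset D -> dimer_fun D mu ->
  step H mu x y -> same_class D x y.
Proof.
move=> sHD [muK muD] /stepP[i Hi Exy]; have [j Dj Ey] := muD y.
have Di := subsetP sHD i Hi.
apply/same_classP; split=> [|k Dk]; first by apply: negb_inj; rewrite -(par_flip i) Exy Ey par_flip.
have nk l : l \in D -> k != l by move=> Dl; apply: contraNneq Dk => ->.
by rewrite -(@flip_neq _ i k x) ?nk // Exy Ey flip_neq ?nk.
Qed.

Lemma path_class D H mu x p : H \subset D -> dimer_fun D mu ->
  path (step H mu) x p -> same_class D x (last x p).
Proof.
move=> sHD dmu; elim: p x => [|y p IHp] x /=; first by move=> _; apply/same_classP.
case/andP => /(step_class sHD dmu)/same_classP[pxy xy] /IHp/same_classP[pyz yz].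
by apply/same_classP; split=> [|i Di]; [rewrite pxy|rewrite xy ?yz].
Qed.

(** Conjugation by [mu] reverses [step], so an alternating walk read backwards is a walk between the
    partners. *)
Lemma step_rev H mu x y : involutive mu -> step H mu x y -> step H mu (mu y) (mu x).
Proof.
by move=> muK /stepP[i Hi Exy]; apply/stepP; exists i; rewrite // muK -Exy flipK.
Qed.

Lemma path_rev H mu x p : involutive mu -> path (step H mu) x p ->
  exists q, [/\ path (step H mu) (mu (last x p)) q, last (mu (last x p)) q = mu x
    & size q = size p].
Proof.
move=> muK; elim: p x => [|y p IHp] x /=; first by exists nil.
case/andP => /(step_rev muK) sxy /IHp[q [pq lq sq]].
by exists (rcons q (mu x)); rewrite rcons_path pq lq sxy last_rcons size_rcons sq.
Qed.

Fixpoint reach H mu x k : {set V} :=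
  if k is k'.+1 then x |: mu @: nbh H (reach H mu x k') else [set x].

Lemma nbh_step H mu A z : involutive mu -> z \in mu @: nbh H A ->
  exists2 y, y \in A & step H mu y z.
Proof.
move=> muK /imsetP[w /nbhP[i Hi Aw] ->]; exists (flip i w) => //.
by apply/stepP; exists i; rewrite // flipK muK.
Qed.

Lemma reach_path H mu x k z : involutive mu -> z \in reach H mu x k ->
  exists p, [/\ path (step H mu) x p, last x p = z & size p <= k].
Proof.
move=> muK; elim: k z => [|k IHk] z /=; first by move/set1P->; exists nil.
case/setU1P => [->|]; first by exists nil.
case/(nbh_step muK) => y /IHk[p [pp lp sp]] syz.
by exists (rcons p z); rewrite rcons_path pp lp syz last_rcons size_rcons.
Qed.

Lemma card_reach H m mu x k : #|H| = m.+1 -> involutive mu ->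
  binsum m k.+1 <= #|reach H mu x k|.
Proof.
move=> cH muK; elim: k => [|k IHk] /=; first by rewrite /binsum big_ord1 bin0 cards1.
apply: leq_trans (subset_leq_card (subsetUr _ _)).
by rewrite card_imset ?(nbh_ball cH) //; apply: can_inj muK.
Qed.

(* The dimers reached forwards from x and backwards to x lie in the same class
   of 2 ^ m.+1 vertices and together number more than that; F omits the walk of
   length 0, so that the meeting point gives a nonempty closed walk. *)
Lemma closed_walk D H m mu x : H \subset D -> #|D| = m.+2 -> #|H| = m.+1 ->
  dimer_fun D mu ->
  exists y p, [/\ path (step H mu) x (y :: p), last y p = x & size p <= m.*2.+1].
Proof.
move=> sHD cD cH dmu; have [muK muD] := dmu; have mu_inj := can_inj muK.
(* The ball is already the whole m-cube: ['C(m, m.+1) = 0], so one more neighbourhood still has at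
   least [2 ^ m] elements, half of the class. *)
have card_nbh y : 2 ^ m <= #|mu @: nbh H (reach H mu y m)|.
  rewrite card_imset // -binsum_pow -[binsum _ _]addn0 -(@bin_small m m.+1) //.
  by rewrite -binsumSr (nbh_ball cH) ?card_reach.
(* If the search from [mu x] returns to [mu x], the reversed walk is closed at [x]. Otherwise [mu x]
   is an extra element, which makes [G] larger than half of the class. *)
have [xR|xR] := boolP (mu x \in mu @: nbh H (reach H mu (mu x) m)).
  have [y /(reach_path muK)[p [pp lp sp]] /(step_rev muK)] := nbh_step muK xR.
  have [q [pq lq sq]] := path_rev muK pp.
  rewrite -lp muK => sxy; exists (mu (last (mu x) p)), q.
  by rewrite /= sxy pq lq muK sq; split=> //; apply: leq_trans sp _; lia.
pose F := mu @: nbh H (reach H mu x m); pose G := mu @: reach H mu (mu x) m.+1.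
have cF : 2 ^ m <= #|F| by apply: card_nbh.
have cG : 2 ^ m < #|G| by rewrite card_imset //= cardsU1 xR ltnS card_nbh.
have F_path z : z \in F ->
    exists y p, [/\ path (step H mu) x (y :: p), last y p = z & size p <= m].
  case/(nbh_step muK) => y /(reach_path muK)[p [pp lp sp]] syz.
  have : path (step H mu) x (rcons p z) by rewrite rcons_path pp lp syz.
  case: p sp {pp lp} => [|w p] /= sp pp; first by exists z, nil.
  by exists w, (rcons p z); rewrite last_rcons size_rcons.
have G_path z : z \in G ->
    exists p, [/\ path (step H mu) z p, last z p = x & size p <= m.+1].
  case/imsetP => w /(reach_path muK)[p [pp lp sp]] ->.
  have [q [pq lq sq]] := path_rev muK pp.
  by move: pq lq; rewrite lp muK => pq lq; exists q; rewrite sq.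
have [z Fz Gz] : exists2 z, z \in F & z \in G.
  have [/eqP FG|[z /setIP[]]] := set_0Vmem (F :&: G); last by exists z.
  suff /(leq_trans (leq_add cF cG)) : #|F| + #|G| <= 2 ^ m.+1.
    by rewrite expnS mul2n -addnn addnS ltnn.
  rewrite -cardsUI (eqP FG) cards0 addn0.
  apply: leq_trans (card_same_class x cD); apply/subset_leq_card/subsetP => z.
  case/setUP => [/F_path[y [p [pp <- _]]]|/G_path[p [pp lp _]]].
    exact: (path_class sHD dmu pp).
  have /same_classP[pz zx] := path_class sHD dmu pp.
  by apply/same_classP; rewrite -lp; split=> // i /zx.
have [y [p [pp lp sp]]] := F_path z Fz; have [q [pq lq sq]] := G_path z Gz.
exists y, (p ++ q); rewrite -cat_cons cat_path pp /= lp pq last_cat lp lq size_cat.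
by split=> //; apply: leq_trans (leq_add sp sq) _; lia.
Qed.

(** The closed walk is shortened to a simple one. It cannot have length 1, as a step from [x] to
    itself would use the direction [v] of its dimer. *)
Lemma short_cycle D v m mu x : v \in D -> #|D| = m.+2 -> dimer_fun D mu ->
  mu x = flip v x ->
  exists t, [/\ cycle (step (D :\ v) mu) (x :: t), uniq (x :: t), 0 < size t
    & size t <= m.*2.+1].
Proof.
move=> Dv cD dmu mux.
have cH : #|D :\ v| = m.+1 by move: cD; rewrite (cardsD1 v D) Dv => -[].
have [y [p [/= /andP[sxy pp]]]] := closed_walk x (subD1set D v) cD cH dmu.
case/shortenP: pp => q pq /= /andP[yq uq] sqp lq sp.
have {}sp : size q <= m.*2.+1 by apply: leq_trans (uniq_leq_size uq sqp) sp.
case/lastP: q => [|q w] in pq yq uq sqp lq sp *.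
  move: sxy; rewrite /= in lq; rewrite lq => /stepP[i /setD1P[iv _]].
  by rewrite mux => /flip_dir Eiv; rewrite Eiv eqxx in iv.
rewrite last_rcons in lq; rewrite lq in pq yq uq sp; rewrite size_rcons in sp.
have: uniq (rcons (y :: q) x) by rewrite rcons_cons /= yq.
by rewrite rcons_uniq => u; exists (y :: q); split=> //; rewrite /= sxy.
Qed.

End Cycle.

(** * Perfect matchings as involutions *)

Section Matching.
Variable d : nat.
Local Notation V := {ffun 'I_d -> bool}.
Implicit Types (x y z : V) (i j v : 'I_d) (D H : {set 'I_d}) (mu : V -> V).

Definition matching_of mu : {set {set V}} := [set [set x; mu x] | x : V].

Lemma dimer_par D mu x : dimer_fun D mu -> par (mu x) = ~~ par x.
Proof. by case=> _ /(_ x)[i _ ->]; apply: par_flip. Qed.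

Lemma matching_ofP D mu E : dimer_fun D mu ->
  reflect (exists2 x, ~~ par x & E = [set x; mu x]) (E \in matching_of mu).
Proof.
move=> dmu; have [muK _] := dmu; apply: (iffP imsetP) => [[x _ ->]|[x _ ->]]; last by exists x.
have [px|px] := boolP (par x); last by exists x.
by exists (mu x); rewrite ?(dimer_par _ dmu) ?px // muK setUC.
Qed.

Lemma pair_par x y x' y' : ~~ par x -> par y -> ~~ par x' -> par y' ->
  [set x; y] = [set x'; y'] -> x = x' /\ y = y'.
Proof.
move=> px py px' py' E; split.
  have: x \in [set x'; y'] by rewrite -E set21.
  by case/set2P => // Ex; rewrite Ex py' in px.
have: y \in [set x'; y'] by rewrite -E set22.
by case/set2P => // Ey; rewrite Ey (negPf px') in py.
Qed.

Lemma perfect_matching_of D mu : dimer_fun D mu ->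
  perfect_matching (hypercube d) (matching_of mu).
Proof.
move=> [muK muD]; apply/andP; split.
  apply/subsetP => _ /imsetP[x _ ->]; rewrite inE; apply/existsP; exists x.
  by apply/existsP; exists (mu x); have [i _ ->] := muD x; rewrite hypercube_flip eqxx.
apply/forallP => x; apply/cards1P; exists [set x; mu x]; apply/setP => E.
rewrite !inE; apply/andP/eqP => [[/imsetP[y _ ->]]|->]; last first.
  by split; [apply/imsetP; exists x|rewrite set21].
by case/set2P => ->; rewrite ?muK // setUC.
Qed.

(** Each vertex is sent to the other end of its dimer; uniqueness of the dimer at [mu x] makes this
    involutive. *)
Lemma perfect_matching_fun (M : {set {set V}}) : perfect_matching (hypercube d) M ->
  exists2 mu, dimer_fun setT mu & M = matching_of mu.
Proof.
case/andP => /subsetP sM /forallP cM.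
have uniqM x E E' : E \in M -> E' \in M -> x \in E -> x \in E' -> E = E'.
  have /cards1P[F /setP EF] := cM x; move=> ME ME' xE xE'.
  have := EF E; have := EF E'; rewrite !inE ME ME' xE xE' /=.
  by move=> /esym/eqP-> /esym/eqP->.
have adjM x y : [set x; y] \in M -> hypercube d x y.
  move/sM; rewrite inE => /existsP[a /existsP[b /andP[/hypercubeP[i ->] /eqP E]]].
  have neq_flip w : w != flip i w.
    by apply/eqP => /(congr1 (@par d)); rewrite par_flip; case: (par w).
  have := set21 x y; have := set22 x y; rewrite E => /set2P hy /set2P hx.
  case: hx hy => Ex [] Ey; rewrite Ex Ey ?hypercube_flip //.
  - have := set22 a (flip i a); rewrite -E Ex Ey setUid => /set1P Ea.
    by have := neq_flip a; rewrite Ea eqxx.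
  - by rewrite hypercube_sym hypercube_flip.
  have := set21 a (flip i a); rewrite -E Ex Ey setUid => /set1P Ea.
  by have := neq_flip a; rewrite -Ea eqxx.
have [mu muP] : exists mu : V -> V, forall x, [set x; mu x] \in M.
  apply: (fin_all_exists (P := fun x y => [set x; y] \in M)) => x.
  have /cards1P[E /setP/(_ E)] := cM x; rewrite !inE eqxx => /andP[ME xE].
  have := sM E ME; rewrite inE => /existsP[a /existsP[b /andP[_ /eqP Eab]]].
  move: xE; rewrite Eab => /set2P[] ->; first by exists b; rewrite -Eab.
  by exists a; rewrite setUC -Eab.
have muK : involutive mu.
  move=> x; have E := uniqM (mu x) _ _ (muP (mu x)) (muP x) (set21 _ _) (set22 _ _).
  have := set22 (mu x) (mu (mu x)); rewrite E => /set2P[] // Emu.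
  have := adjM _ _ (muP (mu x)); rewrite {1}Emu.
  move=> /hypercubeP[i]/(congr1 (@par d)); rewrite par_flip.
  by case: (par _).
exists mu.
  by split=> // x; have /hypercubeP[i ->] := adjM _ _ (muP x); exists i; rewrite ?inE.
apply/setP => E; apply/idP/imsetP => [ME|[x _ ->]]; last exact: muP.
have := sM E ME; rewrite inE => /existsP[a /existsP[b /andP[_ /eqP Eab]]].
by exists a => //; apply: (uniqM a); rewrite ?muP ?set21 // Eab set21.
Qed.

End Matching.

(** * Switching along a cycle of steps *)

Section Switch.
Variable d : nat.
Local Notation V := {ffun 'I_d -> bool}.
Variables (D H : {set 'I_d}) (mu : V -> V) (s : seq V).
Implicit Types (x y z : V) (i : 'I_d).
Hypotheses (sHD : H \subset D) (dmu : dimer_fun D mu).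
Hypotheses (cyc_s : cycle (step H mu) s) (uniq_s : uniq s) (size_s : 1 < size s).
Hypothesis even_s : all (fun z => ~~ par z) s.

Let muK : involutive mu. Proof. by case: dmu. Qed.
Let mu_inj := can_inj muK.
Let par_mu x : par (mu x) = ~~ par x. Proof. exact: dimer_par dmu. Qed.

Let next_out x : x \notin s -> next s x = x.
Proof. by rewrite next_nth => /negPf->. Qed.

Let par_next x : par (next s x) = par x.
Proof.
have [sx|/next_out-> //] := boolP (x \in s).
have sx' : next s x \in s by rewrite mem_next.
by rewrite (negPf (allP even_s _ sx)) (negPf (allP even_s _ sx')).
Qed.

Let par_prev x : par (prev s x) = par x.
Proof. by rewrite -par_next next_prev. Qed.

(** The odd branch inverts the even one. Off the cycle [next] and [prev] are the identity by
    default, so [mu] remains. *)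
Definition switch_fun x := if par x then prev s (mu x) else mu (next s x).

Lemma switch_funE x : ~~ par x -> switch_fun x = mu (next s x).
Proof. by rewrite /switch_fun => /negPf->. Qed.

Lemma switch_fun_out x : ~~ par x -> x \notin s -> switch_fun x = mu x.
Proof. by move=> px xs; rewrite switch_funE // next_out. Qed.

Lemma switch_fun_in x : x \in s -> exists2 i, i \in H & switch_fun x = flip i x.
Proof.
move=> sx; have /stepP[i Hi Ei] := next_cycle cyc_s sx.
by exists i; rewrite // switch_funE ?(allP even_s).
Qed.

Lemma switch_dimer_fun : dimer_fun D switch_fun.
Proof.
have swK : involutive switch_fun.
  move=> x; rewrite /switch_fun; case: (boolP (par x)) => px.
    by rewrite par_prev par_mu px /= next_prev // muK.
  by rewrite par_mu par_next px /= muK prev_next.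
have even_sw x : ~~ par x -> exists2 i, i \in D & switch_fun x = flip i x.
  move=> px; have [/switch_fun_in[i Hi ->]|xs] := boolP (x \in s).
    by exists i; rewrite ?(subsetP sHD).
  by rewrite switch_fun_out //; case: dmu => _; apply.
split=> // x; have [px|] := boolP (par x); last exact: even_sw.
have psx : ~~ par (switch_fun x) by rewrite /switch_fun px par_prev par_mu px.
have [i Di Ei] := even_sw _ psx; exists i => //.
by apply: (can_inj (flipK i)); rewrite -Ei swK flipK.
Qed.

(* Each even vertex is listed after its partner, so the dimers of the cycle are
   at even positions. *)
Definition switch_cycle := flatten [seq [:: mu z; z] | z <- s].

Lemma mem_flat (t : seq V) w :
  (w \in flatten [seq [:: mu z; z] | z <- t]) = (w \in t) || (mu w \in t).
Proof.
elim: t => //= z t IHt; rewrite !inE IHt (inv_eq muK).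
by case: (w == z) (w == mu z) (w \in t) => [] [] [].
Qed.

Lemma size_flat (t : seq V) : size (flatten [seq [:: mu z; z] | z <- t]) = (size t).*2.
Proof. by elim: t => //= z t ->. Qed.

Lemma uniq_switch_cycle : uniq switch_cycle.
Proof.
rewrite /switch_cycle; elim: s uniq_s even_s => //= z t IHt /andP[zt ut] /andP[pz pt].
rewrite IHt // andbT inE !mem_flat muK !negb_or zt /=.
have oddmu w : ~~ par w -> mu w \notin t.
  by move=> pw; apply/negP => /(allP pt) /=; rewrite par_mu pw.
rewrite !oddmu //= !andbT.
by apply/eqP => /(congr1 (@par d)); rewrite par_mu; case: (par z).
Qed.

Lemma cycle_flat (Q : rel V) (t : seq V) :
  cycle [rel x y | Q x (mu y) && Q (mu y) y] t ->
  cycle Q (flatten [seq [:: mu z; z] | z <- t]).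
Proof.
have pathQ x u : path [rel x y | Q x (mu y) && Q (mu y) y] x u ->
    path Q x (flatten [seq [:: mu z; z] | z <- u]).
  elim: u x => //= y u IHu x /andP[/andP[-> ->] /IHu].
  by [].
case: t => //= x t /pathQ; rewrite map_rcons -cats1 flatten_cat cat_path /=.
move=> /and3P[pt Qx /andP[Qm _]].
by rewrite Qm rcons_path pt.
Qed.

Let partner x := if par x then mu x else mu (next s x).

Lemma next_switch_cycle x : x \in switch_cycle -> next switch_cycle x = partner x.
Proof.
move=> xc; apply: nextE xc; apply: cycle_flat.
have /sub_in_cycle := cycle_next uniq_s; apply; last exact: even_s.
move=> x' y px' _ /eqP <- /=; have {}px' : ~~ par x' := px'.
by rewrite /partner /= (negPf px') eqxx par_mu par_next px' muK eqxx.
Qed.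

Lemma mem_cycle_edges E : reflect
  (exists2 z, z \in s & E = [set z; mu z] \/ E = [set z; mu (next s z)])
  (E \in cycle_edges switch_cycle).
Proof.
apply: (iffP mapP) => [[x xc ->]|[z zs]].
  move: (xc); rewrite mem_flat next_switch_cycle // /partner => /orP[xs|xs].
    by exists x; rewrite // (negPf (allP even_s _ xs)); right.
  have := allP even_s _ xs; rewrite par_mu negbK => ->.
  by exists (mu x); rewrite // muK setUC; left.
have pz := allP even_s _ zs.
case=> ->; [exists (mu z)|exists z]; rewrite ?mem_flat ?muK ?zs ?orbT //.
  by rewrite next_switch_cycle ?mem_flat ?muK ?zs ?orbT // /partner par_mu pz muK setUC.
by rewrite next_switch_cycle ?mem_flat ?muK ?zs ?orbT // /partner (negPf pz).
Qed.

Let next_neq z : z \in s -> next s z != z.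
Proof.
move=> zs; have [i t Et] := rot_to zs.
rewrite -(next_rot i uniq_s) Et; move: uniq_s size_s.
rewrite -(rot_uniq i) -(size_rot i) Et; case: t {Et} => //= y t.
by rewrite inE negb_or eqxx eq_sym => /and3P[/andP[]].
Qed.

Lemma switch_matching :
  switch (matching_of mu) switch_cycle = matching_of switch_fun.
Proof.
apply/setP => E; rewrite !inE.
apply/orP/(matching_ofP _ switch_dimer_fun).
  case=> /andP[].
    move=> nE /(matching_ofP _ dmu)[x px Ex]; exists x => //.
    rewrite switch_fun_out //; apply: contra nE => xs.
    by apply/mem_cycle_edges; exists x; [|left].
  move=> nE /mem_cycle_edges[z zs [] Ez].
    by case/negP: nE; apply/(matching_ofP _ dmu); exists z; rewrite ?(allP even_s).
  have pz := allP even_s _ zs.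
  by exists z; rewrite ?switch_funE.
case=> x px ->; have [xs|xs] := boolP (x \in s).
  right; apply/andP; split; last first.
    by apply/mem_cycle_edges; exists x; rewrite // switch_funE //; right.
  (* If the new dimer at [x] were an old one, [x] would be its own successor, which a cycle of at
     least two steps excludes. *)
  apply/(matching_ofP _ dmu) => -[y py]; rewrite switch_funE //.
  case/pair_par; rewrite ?par_mu ?par_next ?px ?py // => <- /mu_inj/eqP.
  by rewrite (negPf (next_neq xs)).
left; rewrite switch_fun_out //; apply/andP; split; last first.
  by apply/(matching_ofP _ dmu); exists x.
apply/mem_cycle_edges => -[z zs E'].
have pz := allP even_s _ zs.
suff Ex : x = z by rewrite Ex zs in xs.
by case: E' => /pair_par[]; rewrite ?par_mu ?par_next ?px ?pz.
Qed.

Lemma switch_cycle_alternating :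
  alternating_cycle (hypercube d) (matching_of mu) switch_cycle.
Proof.
have sz : size switch_cycle = (size s).*2 by apply: size_flat.
apply/and4P; split; last 1 first.
- apply/existsP; exists false; apply/forallP => k; apply/implyP; rewrite eqbF_neg => ek.
  have [x0 _] : exists x0, x0 \in s.
    by case: s size_s => // x0 t _; exists x0; rewrite mem_head.
  rewrite (nth_map x0) ?ltn_ord //; set x := nth x0 _ _.
  have xc : x \in switch_cycle by apply: mem_nth.
  suff px : par x by rewrite next_switch_cycle // /partner px; apply/imsetP; exists x.
  have {xc} : (k < size switch_cycle) by [].
  rewrite /x /switch_cycle; move: {k x}(k : nat) ek.
  elim: s even_s => //= z t IHt /andP[pz pt] [|[|k]] //= ek lek.
    by rewrite par_mu.
  by apply: IHt => //; rewrite ?negbK // in ek.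
- apply/andP; split; last exact: uniq_switch_cycle.
  apply: cycle_flat; apply: sub_cycle cyc_s => x y /stepP[i _ Ei] /=.
  rewrite -Ei hypercube_flip Ei hypercube_sym.
  by have [_ /(_ y)[j _ ->]] := dmu; rewrite hypercube_flip.
- by rewrite sz; move: size_s; lia.
by rewrite sz odd_double.
Qed.

End Switch.

(** * Bounded walks and the diameter *)

Section Distance.
Variables (T : finType) (e : rel T).

Definition within n (x y : T) := exists p, [/\ path e x p, last x p = y & size p <= n].

Lemma within_trans n1 n2 x y z : within n1 x y -> within n2 y z -> within (n1 + n2) x z.
Proof.
move=> [p [pp <- sp]] [q [pq <- sq]]; exists (p ++ q).
by rewrite cat_path pp pq last_cat size_cat leq_add.
Qed.

Lemma within_sym n x y : symmetric e -> within n x y -> within n y x.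
Proof.
move=> e_sym [p [pp <- sp]]; exists (rev (belast x p)); split.
- by rewrite rev_path (eq_path (e' := e)).
- by case: p {pp sp} => //= y' p; rewrite rev_cons last_rcons.
by rewrite size_rev size_belast.
Qed.

Lemma within_gdist n x y : within n x y -> gdist e x y <= n.
Proof.
move=> [p [pp lp sp]]; apply: leq_trans sp; rewrite /gdist.
(* The search in [gdist] stops at [#|T|], which already bounds the result when the walk is that
   long. *)
have [lt_pT|le_Tp] := ltnP (size p) #|T|; last first.
  by apply: leq_trans (find_size _ _) _; rewrite size_iota.
rewrite leqNgt; apply/negP => /(before_find 0); rewrite nth_iota // add0n => /existsP[].
by exists (in_tuple p); rewrite pp lp eqxx.
Qed.

Lemma within_diameter n : (forall x y, within n x y) -> diameter e <= n.
Proof. by move=> W; apply/bigmax_leqP => x _; apply/bigmax_leqP => y _; apply: within_gdist. Qed.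

Lemma within_connect n x y : within n x y -> connect e x y.
Proof. by case=> p [pp <- _]; apply/connectP; exists p. Qed.

End Distance.

(** * Removal of one direction, and the distance bound *)

Section Elimination.
Variable d : nat.
Local Notation V := {ffun 'I_d -> bool}.
Local Notation config := (dimer_config (hypercube d)).
Implicit Types (x y z : V) (i j v : 'I_d) (D H : {set 'I_d}) (mu nu : V -> V).

(* Only vertical dimers change the coordinate v along the cycle, so it contains
   them in both orientations. *)
Lemma short_even_cycle D v m mu x : v \in D -> #|D| = m.+2 -> dimer_fun D mu ->
  mu x = flip v x ->
  exists s, [/\ cycle (step (D :\ v) mu) s, uniq s, 1 < size s <= m.*2.+2,
    all (fun z => ~~ par z) s & exists w, [/\ w \in s, ~~ w v & mu w = flip v w]].
Proof.
move=> Dv cD dmu; have [muK muD] := dmu.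
wlog px : x / ~~ par x => [W|mux].
  have [px|px] := boolP (par x); last exact: W.
  by move=> mux; apply: (W (mu x)); rewrite ?muK ?mux ?flipK // par_flip px.
have [t [ct ut t_gt0 t_le]] := short_cycle Dv cD dmu mux.
move: (ct); rewrite /= rcons_path => /andP[pt stepx].
have even_t : all (fun z => ~~ par z) (x :: t).
  rewrite /= px; have: path [rel y z | par y == par z] x t.
    apply: sub_path pt => y z /(step_class (subD1set D v) dmu)/same_classP[pyz _].
    by rewrite /= pyz.
  have tr : transitive [rel y z : V | par y == par z] by move=> ? ? ? /= /eqP->.
  by move/(order_path_min tr); apply: sub_all => z /= /eqP<-.
exists (x :: t); split=> //; first by rewrite /= !ltnS t_gt0.
have [xv|xv] := boolP (x v); last by exists x; rewrite mem_head.
case: (boolP (has (fun w : V => ~~ w v && (mu w == flip v w)) (x :: t))).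
  by case/hasP => w wt /andP[wv /eqP Ew]; exists w.
move=> /hasPn no_w.
(* In the absence of such a [w], coordinate [v] stays true once it is true, so the step closing the
   cycle at [x] could not use a vertical dimer. *)
have nonvert y z : z \in x :: t -> step (D :\ v) mu y z -> y v ->
    mu z != flip v z /\ z v.
  move=> zt /stepP[i /setD1P[iv _] Eyz] yv; have [j _ Ez] := muD z.
  have := congr1 (fun w : V => w v) Eyz; rewrite flip_neq 1?eq_sym // yv Ez.
  have [jv|jv] := eqVneq v j.
    by have := no_w z zt; rewrite Ez -jv eqxx andbT negbK flipE => ->.
  rewrite flip_neq // => <-; split=> //.
  by apply: contra_neq jv => /flip_dir.
have: path [rel y z | (y : V) v ==> (z : V) v] x t.
  apply: (sub_in_path (P := mem (x :: t))) pt => [y z _ zt syz|]; last exact/allP.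
  by apply/implyP => yv; have [] := nonvert y z zt syz yv.
have tr : transitive [rel y z : V | y v ==> z v].
  by move=> ? ? ? /= /implyP yz /implyP zw; apply/implyP => /yz.
move/(order_path_min tr)/allP => x_le.
have lv : last x t v.
  by have := mem_last x t; rewrite inE => /predU1P[-> //|/x_le]; rewrite /= xv.
have [] := nonvert _ _ (mem_head _ _) stepx lv.
by rewrite mux eqxx.
Qed.

(* Half of the vertical dimers, namely those whose even end has v-coordinate
   false: each switch along a cycle as above removes at least one of them. *)
Definition vertical v mu := [set x | [&& ~~ par x, ~~ x v & mu x == flip v x]].

Lemma card_flip_sub i (A B : {set V}) : A \subset B -> flip i @: A \subset B ->
  [disjoint A & flip i @: A] -> 2 * #|A| <= #|B|.
Proof.
move=> sAB sfB dis; rewrite mul2n -addnn -[X in _ + X](card_imset _ (can_inj (flipK i))).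
move: dis; rewrite -(leq_card_setU A (flip i @: A)) => /eqP <-.
by rewrite subset_leq_card // subUset sAB.
Qed.

(** The even vertices counted and their flips along [i] are disjoint in the half-cube where
    coordinate [v] is false, so the count is at most a quarter of the cube. *)
Lemma card_vertical v i mu : i != v -> #|vertical v mu| <= 2 ^ (d - 2).
Proof.
move=> iv; have lt_d : 1 < d.
  by have := max_card (mem [set i; v]); rewrite cards2 iv card_ord.
pose B := [set x : V | ~~ x v].
have le_vB : 2 * #|vertical v mu| <= #|B|.
  apply: (@card_flip_sub i).
  - by apply/subsetP => x; rewrite !inE => /and3P[].
  - apply/subsetP => _ /imsetP[x + ->]; rewrite !inE => /and3P[_ xv _].
    by rewrite flip_neq // eq_sym.
  rewrite disjoint_subset; apply/subsetP => x; rewrite !inE => /and3P[px _ _].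
  apply/imsetP => -[y + Ex]; rewrite !inE => /and3P[py _ _].
  by rewrite Ex par_flip py in px.
have le_BV : 2 * #|B| <= #|[set: V]|.
  apply: (@card_flip_sub v); rewrite ?subsetT // disjoint_subset.
  apply/subsetP => x; rewrite !inE => xv; apply/imsetP => -[y /[!inE] yv Ex].
  by rewrite Ex flipE yv in xv.
rewrite -(@leq_pmul2l (2 * 2)) // -!mulnA -!expnS.
apply: leq_trans (leq_mul (leqnn 2) le_vB) _; apply: leq_trans le_BV _.
by rewrite cardsT card_ffun card_bool card_ord leq_pexp2l //; lia.
Qed.

Lemma vertical_switch D v m mu x : v \in D -> #|D| = m.+2 -> dimer_fun D mu ->
  mu x = flip v x ->
  exists nu c, [/\ dimer_fun D nu, #|vertical v nu| < #|vertical v mu|,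
    alternating_cycle (hypercube d) (matching_of mu) c, size c <= 4 * m.+1 &
    switch (matching_of mu) c = matching_of nu].
Proof.
move=> Dv cD dmu mux.
have [s [cs us /andP[s1 s2] ps [w [ws wv Ew]]]] := short_even_cycle Dv cD dmu mux.
have sHD := subD1set D v.
exists (switch_fun mu s), (switch_cycle mu s); split.
- exact: (switch_dimer_fun sHD dmu cs us ps).
- apply/proper_card/properP; split.
    apply/subsetP => z; rewrite !inE => /and3P[pz zv Ez]; rewrite pz zv /=.
    have [zs|zs] := boolP (z \in s); last by rewrite -(switch_fun_out mu pz zs).
    have [i /setD1P[iv _] Ez'] := switch_fun_in cs ps zs.
    by move: Ez iv; rewrite Ez' => /eqP/flip_dir ->; rewrite eqxx.
  exists w; rewrite !inE ?(allP ps _ ws) ?wv ?Ew ?eqxx //=.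
  have [i /setD1P[iv _] ->] := switch_fun_in cs ps ws.
  by apply: contra_neqN iv => /eqP/flip_dir.
- exact: (switch_cycle_alternating sHD dmu cs).
(* At most [2m + 2] steps, each listing two vertices. *)
- by rewrite size_flat; lia.
exact: (switch_matching sHD dmu cs).
Qed.

Lemma dimer_funD1 D v mu : dimer_fun D mu -> (forall x, mu x != flip v x) ->
  dimer_fun (D :\ v) mu.
Proof.
move=> [muK muD] no_v; split=> // x; have [i Di Ei] := muD x.
by exists i; rewrite // !inE Di andbT; apply: contraNneq (no_v x) => <-; apply/eqP.
Qed.

Variable l : nat.
Local Notation near := (within (dimer_graph (hypercube d) l)).

Lemma dimer_graph_sym : symmetric (dimer_graph (hypercube d) l).
Proof. by move=> M N; rewrite /dimer_graph /= orbC. Qed.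

Lemma eliminate n D v m mu (M : config) : v \in D -> #|D| = m.+2 -> 2 * m.+1 <= l ->
  dimer_fun D mu -> val M = matching_of mu -> #|vertical v mu| <= n ->
  exists nu (N : config), [/\ dimer_fun (D :\ v) nu, val N = matching_of nu & near n M N].
Proof.
move=> Dv cD le_l; elim: n mu M => [|n IHn] mu M dmu EM le_n.
  exists mu, M; split=> //; last by exists nil.
  apply: dimer_funD1 => // x; apply/eqP => mux.
  (* Any vertical dimer, whichever end [x] is, would permit a switch lowering a count that is
     already 0. *)
  by have [nu [c [_]]] := vertical_switch Dv cD dmu mux; rewrite ltnNge (leq_trans le_n).
have [[x /eqP mux]|no_x] := pickP [pred x | mu x == flip v x]; last first.
  exists mu, M; split=> //; last by exists nil.
  by apply: dimer_funD1 => // x; rewrite (negbT (no_x x)).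
have [nu [c [dnu lt_nu altc sc Ec]]] := vertical_switch Dv cD dmu mux.
pose M' : config := Sub (matching_of nu) (perfect_matching_of dnu).
have [|nu' [N [dnu' EN [p [pp lp sp]]]]] := IHn nu M' dnu erefl.
  by rewrite -ltnS (leq_trans lt_nu).
exists nu', N; split=> //; exists (M' :: p); split=> //=; rewrite pp andbT.
apply/orP; left; apply/switchableP; exists c; split; rewrite ?EM //.
by apply: leq_trans sc _; lia.
Qed.

(** Each direction costs [2 ^ (d - 2)] switches at either end of the walk, hence [2 ^ (d - 1)] in
    all. With one direction left, both configurations coincide. *)
Lemma near_configs k D mu nu (M N : config) : #|D| = k.+1 -> 2 * k <= l ->
  dimer_fun D mu -> dimer_fun D nu -> val M = matching_of mu -> val N = matching_of nu ->
  near (k * 2 ^ (d - 1)) M N.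
Proof.
elim: k D mu nu M N => [|k IHk] D mu nu M N cD le_l dmu dnu EM EN.
  exists nil; split=> //=; apply: val_inj; rewrite EM EN; apply: eq_imset => x.
  have [_ /(_ x)[i Di ->]] := dmu; have [_ /(_ x)[j Dj ->]] := dnu.
  by move/eqP/cards1P: cD Di Dj => [v ->] /set1P-> /set1P->.
have [v [i [Dv Di iv]]] : exists v i, [/\ v \in D, i \in D & i != v].
  have /card_gt1P[v [i [Dv Di vi]]] : 1 < #|D| by rewrite cD.
  by exists v, i; rewrite eq_sym.
have d2 : 1 < d by have := max_card (mem D); rewrite cD card_ord; lia.
have [mu' [M' [dmu' EM' nM]]] := eliminate Dv cD le_l dmu EM (card_vertical mu iv).
have [nu' [N' [dnu' EN' nN]]] := eliminate Dv cD le_l dnu EN (card_vertical nu iv).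
have -> : k.+1 * 2 ^ (d - 1) = 2 ^ (d - 2) + (k * 2 ^ (d - 1) + 2 ^ (d - 2)).
  by rewrite (_ : d - 1 = (d - 2).+1) ?expnS; lia.
apply: within_trans nM _; apply: within_trans (within_sym dimer_graph_sym nN).
apply: IHk dmu' dnu' EM' EN'; last by lia.
by move: cD; rewrite (cardsD1 v) Dv => -[].
Qed.

End Elimination.

Theorem theorem1p6 (d : nat) (hd : 2 <= d) :
  connected_graph (dimer_graph (hypercube d) (2 * d - 2)) /\
  diameter (dimer_graph (hypercube d) (2 * d - 2)) <= (d - 1) * 2 ^ (d - 1).
Proof.
have near M N : within (dimer_graph (hypercube d) (2 * d - 2)) ((d - 1) * 2 ^ (d - 1)) M N.
  have [mu dmu EM] := perfect_matching_fun (valP M).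
  have [nu dnu EN] := perfect_matching_fun (valP N).
  (* All d directions are allowed at first, so [k = d - 1] and the requirement [2 * k <= l] is met
     with equality. *)
  apply: near_configs dmu dnu EM EN; last by lia.
  by rewrite cardsT card_ord; lia.
split; last exact: within_diameter.
apply/andP; split; last first.
  by apply/forallP => M; apply/forallP => N; apply: within_connect (near M N).
(* A configuration exists: all dimers parallel to coordinate 0. *)
pose v : 'I_d := Ordinal (ltnW hd).
have dv : dimer_fun setT (flip v) by split=> [|x]; [apply: flipK|exists v; rewrite ?inE].
by apply/card_gt0P; exists (Sub (matching_of (flip v)) (perfect_matching_of dv)).
Qed.
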